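(* Let $q$ be an odd prime power, let $p=\operatorname{char}\mathbb F_q$, and let $d\ge1$. The standard quadratic space $(\mathbb F_q^d,\ Q(x)=x_1^2+\cdots+x_d^2)$ contains a $(d+2)$-point equilateral set with nonzero common squared distance if and only if $$p\mid d+2\qquad\text{and}\qquad\bigl(d\text{ is odd or }q\equiv1\pmod 4\bigr).$$
   Context: A set of points $P_0,\ldots,P_{n-1}\in\mathbb F_q^d$ is equilateral with nonzero common squared distance if there is $\Delta\in\mathbb F_q^*$ such that $Q(P_i-P_j)=\Delta$ for all $i\neq j$. *)

(* Defs.v *)
From HB Require Import structures.
From mathcomp Require Import all_boot all_order all_algebra.

Set Implicit Arguments.
Unset Strict Implicit.
Unset Printing Implicit Defensive.

Import GRing.Theory.
Local Open Scope ring_scope.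

Definition sqform (F : finFieldType) (d : nat) (x : 'rV[F]_d) : F :=
  \sum_(k < d) x 0 k ^+ 2.

(* The points of an equilateral family are automatically pairwise distinct,
   since sqform 0 = 0 whereas Delta != 0. *)
Definition equilateral (F : finFieldType) (d n : nat)
    (P : 'I_n -> 'rV[F]_d) : Prop :=
  exists Delta : F, Delta != 0 /\
    forall i j : 'I_n, i != j -> sqform (P i - P j) = Delta.

(* Main.v *)
(* The Gram matrix of the differences of m + 1 equilateral points is c (I + J)
   of order m, with determinant c^m (m + 1).  For m = d + 1 it is singular, as
   the points live in dimension d, so d + 2 = 0 in F.  For m = d it is V V^T
   with V square, so - c^d is a square, and hence so is -1 when d is even.

   Conversely, there is a matrix B of order d + 1 with B B^T = - I, built from
   blocks (a b; -b a) with a^2 + b^2 = -1 when d is odd, and equal to i I when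
   i^2 = -1.  The sum s of its rows satisfies s.s = - (d + 1) = 1, and its rows
   together with - s are d + 2 points at squared distance -2 from each other,
   all in the hyperplane x.s = -1.  A reflection maps s to e_1, and dropping
   the first coordinate then yields points of F^d. *)

Require Import Defs.
From mathcomp Require Import all_boot all_order all_algebra.
From mathcomp Require Import cyclic finfield ring zify.

Set Implicit Arguments.
Unset Strict Implicit.
Unset Printing Implicit Defensive.

Import GRing.Theory.
Local Open Scope ring_scope.

Lemma odd_card_two_neq0 (F : finFieldType) : odd #|F| -> 2%:R != 0 :> F.
Proof.
move=> oddF; apply/negP=> two0.
have pchar2 : 2%N \in [pchar F] by rewrite inE.
have cardF : #|F| = (2 ^ logn 2 #|F|)%N := card_pprimeChar pchar2.
have := finNzRing_gt1 F; move: oddF; rewrite cardF oddX orbF => /eqP ->.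
by [].
Qed.

(** With q the order of the field, x = x^q = x (-1)^((q-1)/2), and 1 != -1 then forces (q-1)/2 to be
    even. *)
Lemma sqrt_opp1_card_mod4 (F : finFieldType) (x : F) :
  odd #|F| -> x ^+ 2 = -1 -> #|F| = 1 %[mod 4].
Proof.
move=> oddF x2; have two0 := odd_card_two_neq0 oddF.
have x0 : x != 0.
  by apply: contra_eq_neq x2 => ->; rewrite expr0n /= eq_sym oppr_eq0 oner_eq0.
have cardF : #|F| = ((#|F|./2).*2).+1.
  by rewrite -[LHS]odd_double_half oddF.
have : x ^+ #|F| = x by exact: expf_card.
rewrite {1}cardF exprS -mul2n exprM x2 -signr_odd => /(canRL (mulKf x0)).
rewrite mulVf //; case: (boolP (odd _)) => [_ /eqP | even_half _].
  by rewrite expr1 eq_sym -subr_eq0 opprK (negbTE two0).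
rewrite cardF; lia.
Qed.

(** There are 4m nonzero elements and X^(2m) - 1 has at most 2m roots, so some nonzero z has z^(2m)
    != 1. Then z^(2m) = -1, and z^m is the required element. *)
Lemma card_mod4_sqrt_opp1 (F : finFieldType) :
  #|F| = 1 %[mod 4] -> exists x : F, x ^+ 2 = -1.
Proof.
move=> mod4; have gt1 : (1 < #|F|)%N := finNzRing_gt1 F.
have [m cardF] : exists m, #|F| = (m * 2 * 2).+1.
  by exists (#|F| %/ 4)%N; lia.
have m0 : (0 < m * 2)%N by lia.
have [z z0 zm] : exists2 z : F, z != 0 & z ^+ (m * 2) != 1.
  pose rs := enum [pred z : F | z != 0].
  have size_rs : size rs = (m * 2 * 2)%N.
    by rewrite -cardE cardC1 cardF.
  case: (boolP (all (m * 2).-unity_root rs)) => [unity|].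
    have := max_unity_roots m0 unity (enum_uniq _); rewrite size_rs; lia.
  by case/allPn=> z; rewrite mem_enum inE unity_rootE => z0 zm; exists z.
exists (z ^+ m); rewrite -exprM.
have : (z ^+ (m * 2)) ^+ 2 == 1.
  rewrite -exprM; apply/eqP/(mulfI z0).
  by rewrite -exprS -cardF expf_card mulr1.
by rewrite sqrf_eq1 (negbTE zm) => /eqP.
Qed.

(** Pigeonhole: the squares fill at least half of the field, so if they were disjoint from their
    image under y -> -1 - y, the order of the field would be even. *)
Lemma sum_two_squares_opp1 (F : finFieldType) :
  odd #|F| -> exists a b : F, a ^+ 2 + b ^+ 2 = -1.
Proof.
move=> oddF.
pose S : {set F} := [set x ^+ 2 | x : F]; pose T : {set F} := [set -1 - y | y in S].
have cardT : #|T| = #|S| by apply: card_imset => x y /addrI /oppr_inj.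
have cardS : (#|F| <= #|S| * 2)%N.
  rewrite -[leqLHS]sum1_card (partition_big_imset (fun x : F => x ^+ 2)) /=.
  rewrite -sum_nat_const; apply: leq_sum => _ /imsetP[x _ ->].
  rewrite sum1dep_card.
  (* Each fibre of squaring lies in a pair {x, -x}. *)
  apply: leq_trans (_ : #|[set x; - x]| <= _)%N; last by rewrite cards2; case: eqP.
  by apply: subset_leq_card; apply/subsetP=> y; rewrite !inE eqf_sqr.
have /set0Pn[y] : S :&: T != set0.
  apply/eqP=> ST0; have := cardsUI S T; rewrite ST0 cards0 cardT addn0 addnn.
  rewrite -muln2 => cardU; move: oddF.
  have -> : #|F| = (#|S| * 2)%N by apply/eqP; rewrite eqn_leq cardS -cardU max_card.
  by rewrite oddM andbF.
rewrite inE => /andP[/imsetP[a _ ->] /imsetP[_ /imsetP[b _ ->] ab]].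
by exists a, b; rewrite ab subrK.
Qed.

(** Sylvester's determinant identity, from two factorizations of one block matrix into block
    triangular ones. *)
Lemma det_add1_mulmxC (R : comPzRingType) (m n : nat)
    (A : 'M[R]_(m, n)) (B : 'M[R]_(n, m)) :
  \det (1%:M + A *m B) = \det (1%:M + B *m A).
Proof.
pose M := block_mx 1%:M (- B) A 1%:M.
have -> : \det (1%:M + B *m A) = \det M.
  have -> : M = block_mx (1%:M + B *m A) (- B) 0 1%:M *m block_mx 1%:M 0 A 1%:M.
    by rewrite mulmx_block !(mulmx1, mul0mx, mulmx0, mul1mx, mulNmx, addrK, add0r).
  by rewrite det_mulmx det_ublock det_lblock !det1 !mulr1.
have -> : M = block_mx 1%:M 0 A 1%:M *m block_mx 1%:M (- B) 0 (1%:M + A *m B).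
  rewrite mulmx_block !(mulmx1, mul0mx, mulmx0, mul1mx, mulmxN, addr0).
  by rewrite addrCA addNr addr0.
by rewrite det_mulmx det_ublock det_lblock !det1 !mul1r.
Qed.

(** The all-ones matrix is a column times a row, so Sylvester's identity reduces the determinant to
    order 1. *)
Lemma det_add1_const1 (R : comPzRingType) (n : nat) :
  \det (1%:M + const_mx 1 : 'M[R]_n) = n.+1%:R.
Proof.
have -> : const_mx 1 = (const_mx 1 : 'cV_n) *m (const_mx 1 : 'rV_n) :> 'M[R]_n.
  by apply/matrixP=> i j; rewrite !mxE big_ord1 !mxE mulr1.
rewrite det_add1_mulmxC det_mx11 !mxE /= -natr1 addrC; congr (_ + _).
rewrite (eq_bigr (fun=> 1)) => [|k _]; last by rewrite !mxE mulr1.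
by rewrite sumr_const card_ord.
Qed.

Lemma sqformE (F : finFieldType) (d : nat) (x : 'rV[F]_d) :
  sqform x = (x *m x^T) 0 0.
Proof. by rewrite !mxE; apply: eq_bigr => k _; rewrite !mxE expr2. Qed.

Lemma sqformB (F : finFieldType) (d : nat) (x y : 'rV[F]_d) :
  sqform (x - y) = sqform x + sqform y - 2%:R * (x *m y^T) 0 0.
Proof.
rewrite !mxE /sqform mulr_sumr -big_split -sumrB /=.
by apply: eq_bigr => k _; rewrite !mxE; ring.
Qed.

(** With one point as origin, the rows of V are the differences to it of m other points.
    Polarization gives their products: D on the diagonal and D / 2 off it. *)
Lemma equilateral_gram (F : finFieldType) (d n m : nat)
    (P : 'I_n -> 'rV[F]_d) :
  2%:R != 0 :> F -> (m < n)%N -> equilateral P ->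
  exists2 c : F, c != 0 &
    exists V : 'M[F]_(m, d), V *m V^T = c *: (1%:M + const_mx 1).
Proof.
move=> two0 ltmn [D [D0 distP]].
exists (D / 2%:R); first by rewrite mulf_neq0 ?invr_eq0.
pose f := widen_ord ltmn.
have f_inj : injective f by move=> i j /(congr1 val) /= /val_inj.
pose v i := P (f (lift ord0 i)) - P (f ord0).
exists (\matrix_i v i).
have sq_v i : sqform (v i) = D.
  by apply: distP; rewrite (inj_eq f_inj) eq_sym neq_lift.
have dot_v i j : (v i *m (v j)^T) 0 0 = D / 2%:R * (1 + (i == j)%:R).
  have [<-|neq_ij] := eqVneq; first by rewrite -sqformE sq_v /=; field.
  have : sqform (v i - v j) = D.
    rewrite /v opprB addrA subrK; apply: distP.
    by rewrite (inj_eq f_inj) (inj_eq lift_inj).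
  rewrite sqformB !sq_v => /(canRL (subrK _))/addrI D_dot.
  by rewrite addr0 mulr1 [in RHS]D_dot mulrAC divff ?mul1r.
apply/matrixP=> i j; rewrite !mxE addrC -dot_v !mxE.
by apply: eq_bigr => k _; rewrite !mxE.
Qed.

Lemma equilateral_natr_eq0 (F : finFieldType) (d : nat) (P : 'I_d.+2 -> 'rV[F]_d) :
  2%:R != 0 :> F -> equilateral P -> d.+2%:R = 0 :> F.
Proof.
move=> two0 equiP.
have [c c0 [V gramV]] := equilateral_gram two0 (ltnSn d.+1) equiP.
have : (V *m V^T) \notin unitmx.
  rewrite -row_free_unit; apply/negP=> /eqP rankV.
  by have := mulmx_max_rank V V^T; rewrite rankV ltnn.
rewrite unitmxE unitfE negbK gramV detZ det_add1_const1 mulf_eq0 expf_eq0.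
by rewrite (negbTE c0) => /eqP.
Qed.

Lemma equilateral_sqrt_opp1 (F : finFieldType) (d : nat)
    (P : 'I_d.+2 -> 'rV[F]_d) :
  2%:R != 0 :> F -> ~~ odd d -> equilateral P -> exists x : F, x ^+ 2 = -1.
Proof.
move=> two0 even_d equiP; have d2 := equilateral_natr_eq0 two0 equiP.
have [c c0 [V gramV]] := equilateral_gram two0 (leqnSn d.+1) equiP.
have det2 : \det V ^+ 2 = - (c ^+ d./2) ^+ 2.
  rewrite expr2 -{2}det_tr -det_mulmx gramV detZ det_add1_const1 -exprM muln2.
  rewrite even_halfK //; have -> : d.+1%:R = -1 :> F.
    by apply/eqP; rewrite -addr_eq0 natr1 d2.
  by rewrite mulrN1.
exists (\det V / c ^+ d./2).
by rewrite expr_div_n det2 mulNr divff // !expf_neq0.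
Qed.

(* The reflection that exchanges s and e_1 maps the hyperplane orthogonal to s
   onto the one orthogonal to e_1; dropping the first coordinate of its image
   gives this formula. *)
Definition reflect_drop (F : finFieldType) (d : nat) (s x : 'rV[F]_d.+1) :
    'rV[F]_d :=
  \row_k (x 0 (lift ord0 k) + x 0 ord0 / (1 - s 0 ord0) * s 0 (lift ord0 k)).

Lemma reflect_dropB (F : finFieldType) (d : nat) (s x y : 'rV[F]_d.+1) :
  reflect_drop s x - reflect_drop s y = reflect_drop s (x - y).
Proof. by apply/rowP=> k; rewrite !mxE; ring. Qed.

(** The reflection is an isometry and sends z to a vector with first coordinate 0, so dropping that
    coordinate preserves the form. The proof checks this by expanding the squares. *)
Lemma sqform_reflect_drop (F : finFieldType) (d : nat) (s z : 'rV[F]_d.+1) :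
  sqform s = 1 -> s 0 ord0 != 1 -> (z *m s^T) 0 0 = 0 ->
  sqform (reflect_drop s z) = sqform z.
Proof.
move=> s1 t1; rewrite mxE big_ord_recl mxE => /eqP; rewrite addrC addr_eq0 => /eqP.
move: s1; rewrite /sqform !big_ord_recl => s1.
set t := s 0 ord0 in s1 t1 *; set z0 := z 0 ord0 => zs.
have t1' : 1 - t != 0 by rewrite subr_eq0 eq_sym.
transitivity (\sum_(k < d) z 0 (lift ord0 k) ^+ 2
    + 2%:R * (z0 / (1 - t)) * \sum_(k < d) z 0 (lift ord0 k) * s^T (lift ord0 k) 0
    + (z0 / (1 - t)) ^+ 2 * \sum_(k < d) s 0 (lift ord0 k) ^+ 2).
  rewrite !mulr_sumr -!big_split /=.
  by apply: eq_bigr => k _; rewrite !mxE -/t -/z0; ring.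
(* The two remaining sums are - z0 t, by orthogonality, and 1 - t^2, by the norm of s. *)
rewrite zs (canRL (addKr _) s1) [z0 ^+ 2 + _]addrC -addrA; congr (_ + _).
by field.
Qed.

Lemma equilateral_hyperplane (F : finFieldType) (d n : nat) (s : 'rV[F]_d.+1)
    (P : 'I_n -> 'rV[F]_d.+1) :
  2%:R != 0 :> F -> sqform s = 1 ->
  (forall i j, ((P i - P j) *m s^T) 0 0 = 0) ->
  equilateral P -> exists P' : 'I_n -> 'rV[F]_d, equilateral P'.
Proof.
(* The reflection vector s - e_1 has norm 2 (1 - t), where t is the first coordinate of s. If t = 1,
   then - s defines the same hyperplane direction and has first coordinate -1 != 1. *)
move=> two0; wlog t1 : s / s 0 ord0 != 1 => [reduce|] s1 Ps equiP.
  have [t1|t1] := eqVneq (s 0 ord0) 1; last exact: (reduce s).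
  apply: (reduce (- s)) => //.
  - by rewrite mxE t1 eq_sym -subr_eq0 opprK.
  - by rewrite -s1; apply: eq_bigr => k _; rewrite mxE sqrrN.
  - by move=> i j; rewrite linearN mulmxN mxE Ps oppr0.
have [D [D0 distP]] := equiP.
exists (fun i => reflect_drop s (P i)), D; split=> // i j neq_ij.
by rewrite reflect_dropB sqform_reflect_drop // distP.
Qed.

Lemma equilateral_of_gram_opp1 (F : finFieldType) (d : nat) (B : 'M[F]_d.+1) :
  2%:R != 0 :> F -> d.+2%:R = 0 :> F -> B *m B^T = -1 ->
  exists P : 'I_d.+2 -> 'rV[F]_d, equilateral P.
Proof.
move=> two0 d2 gramB.
pose s : 'rV_d.+1 := const_mx 1 *m B.
pose P (i : 'I_d.+2) := if unlift ord0 i is Some j then row j B else - s.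
have dot_row i j : (row i B *m (row j B)^T) 0 0 = - (i == j)%:R.
  transitivity ((B *m B^T) i j); last by rewrite gramB !mxE.
  by rewrite !mxE; apply: eq_bigr => k _; rewrite !mxE.
have dot_s i : (row i B *m s^T) 0 0 = -1.
  rewrite trmx_mul mulmxA -row_mul gramB mxE (bigD1 i) //= big1 => [|k ki].
    by rewrite !mxE eqxx mulr1 addr0.
  by rewrite !mxE eq_sym (negbTE ki) oppr0 mul0r.
have s1 : sqform s = 1.
  rewrite sqformE /s -mulmxA mulmx_sum_row summxE.
  transitivity (\sum_(i < d.+1) (-1 : F)).
    apply: eq_bigr => i _; rewrite !mxE mul1r -[RHS](dot_s i) !mxE.
    by apply: eq_bigr => k _; rewrite !mxE.
  by rewrite sumr_const card_ord mulNrn; apply/eqP; rewrite eqr_oppLR -addr_eq0 natr1 d2.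
have sqform_row i : sqform (row i B) = -1 by rewrite sqformE dot_row eqxx.
have sqformC (x y : 'rV[F]_d.+1) : sqform (x - y) = sqform (y - x).
  by apply: eq_bigr => k _; rewrite !mxE -opprB sqrrN.
(* The three terms are -1 from the row, 1 from s, and -2 from twice their product. *)
have dist_s i : sqform (row i B - - s) = - 2%:R.
  rewrite sqformB sqform_row linearN mulmxN [X in 2%:R * X]mxE dot_s.
  have -> : sqform (- s) = 1.
    by rewrite -s1; apply: eq_bigr => k _; rewrite mxE sqrrN.
  by ring.
have Ps i : (P i *m s^T) 0 0 = -1.
  by rewrite /P; case: unliftP => // _; rewrite mulNmx mxE -sqformE s1.
apply: (equilateral_hyperplane (P := P) two0 s1) => [i j|].
  by rewrite mulmxBl [LHS]mxE [X in _ + X]mxE !Ps subrr.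
exists (- 2%:R); split; first by rewrite oppr_eq0.
move=> i j; rewrite /P.
case: unliftP => [i'|] ->; case: unliftP => [j'|] ->; rewrite ?eqxx //.
- rewrite (inj_eq lift_inj) => neq_ij.
  by rewrite sqformB !sqform_row dot_row (negbTE neq_ij) /=; ring.
- by rewrite sqformC dist_s.
Qed.

Lemma gram_opp1_even (F : finFieldType) (m : nat) :
  odd #|F| -> exists B : 'M[F]_(m + m), B *m B^T = (-1)%:M.
Proof.
move=> /sum_two_squares_opp1[a [b ab]].
(* Up to a permutation of the indices, this is m diagonal copies of (a b; -b a). *)
exists (block_mx a%:M b%:M (- b)%:M a%:M).
rewrite tr_block_mx !tr_scalar_mx mulmx_block -!scalar_mxM -!raddfD /=.
rewrite !mulNr !mulrN opprK (mulrC a b) addNr (addrC (b * b)) -!expr2 ab.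
by rewrite raddf0 -scalar_mx_block.
Qed.

Local Close Scope ring_scope.

Theorem proposition4p4 (F : finFieldType) (q p d : nat)
    (hq : #|F| = q) (hodd : odd q) (hp : p \in [pchar F]%R) (hd : 1 <= d) :
  (exists P : 'I_(d + 2) -> 'rV[F]_d, equilateral P) <->
  (p %| d + 2) /\ (odd d \/ q = 1 %[mod 4]).
Proof.
rewrite -hq in hodd *; have two0 := odd_card_two_neq0 hodd.
rewrite (dvdn_pcharf hp) addn2; split=> [[P equiP]|[/eqP d2 cond]].
  split; first by rewrite (equilateral_natr_eq0 two0 equiP).
  have [|even_d] := boolP (odd d); [by left | right].
  have [x x2] := equilateral_sqrt_opp1 two0 even_d equiP.
  exact: sqrt_opp1_card_mod4 x2.
have [B gramB] : exists B : 'M[F]_d.+1, (B *m B^T = (-1)%:M)%R.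
  case: cond => [odd_d|/card_mod4_sqrt_opp1[x x2]].
    have -> : d.+1 = (d.+1./2 + d.+1./2)%N by rewrite addnn even_halfK //= odd_d.
    exact: gram_opp1_even.
  by exists (x%:M)%R; rewrite tr_scalar_mx -scalar_mxM -expr2 x2.
apply: (equilateral_of_gram_opp1 (B := B)) => //.
by rewrite gramB raddfN.
Qed.
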